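(* Let $G$ be an amenable group and let $f,g,h:G\to\mathbb{C}$ be functions. The function $$(x,y)\mapsto f(xy)-f(x)g(y)-g(x)f(y)-h(x)h(y)$$ is bounded on $G\times G$ if and only if at least one of the following assertions holds: (1) $f=0$, $g$ is arbitrary and $h\in\mathcal{B}(G)$; (2) $f,g,h\in\mathcal{B}(G)$; (3) $f=a\,m+\varphi$, $\;g=\left(1-\frac{\lambda^{2}}{2}a\right)m-\lambda b-\frac{\lambda^{2}}{2}\varphi$, $\;h=\lambda\,a\,m+b+\lambda\varphi$, where $\lambda\in\mathbb{C}$ is a constant, $a:G\to\mathbb{C}$ is an additive function, $m:G\to\mathbb{C}$ is a bounded multiplicative function and $b,\varphi:G\to\mathbb{C}$ are two bounded functions; (4) $f=\alpha m-\alpha b$, $\;g=\frac{1-\alpha\lambda^{2}}{2}m+\frac{1+\alpha\lambda^{2}}{2}b-\lambda\varphi$, $\;h=\alpha\lambda m-\alpha\lambda b+\varphi$, where $\alpha,\lambda\in\mathbb{C}$ are two constants, $m:G\to\mathbb{C}$ is a multiplicative function and $b,\varphi:G\to\mathbb{C}$ are two bounded functions; (5) $f=f_{0}$, $\;g=g_{0}-\frac{\lambda^{2}}{2}f_{0}-\lambda b$, $\;h=\lambda f_{0}+b$, where $\lambda\in\mathbb{C}$ is a constant, $b:G\to\mathbb{C}$ is a bounded function and $f_{0},g_{0}:G\to\mathbb{C}$ are functions satisfying the sine functional equation $f_{0}(xy)=f_{0}(x)g_{0}(y)+g_{0}(x)f_{0}(y)$ for all $x,y\in G$; (6) $f=-\lambda^{2}f_{0}+\lambda^{2}b$,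 $\;g=\frac{1+\rho^{2}}{2}f_{0}+\rho g_{0}+\frac{1-\rho^{2}}{2}b$, $\;h=\lambda\rho f_{0}+\lambda g_{0}-\lambda\rho b$, where $\rho\in\mathbb{C}$, $\lambda\in\mathbb{C}\setminus\{0\}$ are two constants, $b:G\to\mathbb{C}$ is a bounded function and $f_{0},g_{0}:G\to\mathbb{C}$ are functions satisfying the cosine functional equation $f_{0}(xy)=f_{0}(x)f_{0}(y)-g_{0}(x)g_{0}(y)$ for all $x,y\in G$; (7) $f=\lambda^{2}M+a\,m+b$, $\;g=\beta\lambda\left(1-\frac{1}{2}\beta\lambda\right)M+(1-\beta\lambda)m-\frac{1}{2}\beta^{2}a\,m-\frac{1}{2}\beta^{2}b$, $\;h=\lambda(1-\beta\lambda)M-\lambda m-\beta\,a\,m-\beta b$, where $\beta\in\mathbb{C}$, $\lambda\in\mathbb{C}\setminus\{0\}$ are two constants, $m,M:G\to\mathbb{C}$ are two multiplicative functions such that $m$ is bounded, $a:G\to\mathbb{C}$ is an additive function and $b:G\to\mathbb{C}$ is a bounded function; (8) $f=\frac{1}{2}a^{2}m+\frac{1}{2}a_{1}m+b$, $\;g=-\frac{1}{4}\beta^{2}a^{2}m+\beta\,a\,m-\frac{1}{4}\beta^{2}a_{1}m+m-\frac{1}{2}\beta^{2}b$, $\;h=-\frac{1}{2}\beta\,a^{2}m+a\,m-\frac{1}{2}\beta\,a_{1}m-\beta b$, where $\beta\in\mathbb{C}$ is a constant, $m:G\to\mathbb{C}$ is a nonzero bounded multiplicative function, $a,a_{1}:G\to\mathbb{C}$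 are two additive functions such that $a\neq0$, and $b:G\to\mathbb{C}$ is a bounded function; (9) $g=-\frac{1}{2}\beta^{2}f+(1+\beta a)m+\beta b$ and $h=-\beta f+a\,m+b$, where $\beta\in\mathbb{C}$ is a constant, $a:G\to\mathbb{C}$ is an additive function, $m:G\to\mathbb{C}$ is a nonzero bounded multiplicative function and $b:G\to\mathbb{C}$ is a bounded function such that the function $$(x,y)\mapsto f(xy)m((xy)^{-1})-\tfrac{1}{2}a^{2}(xy)-\left(f(x)m(x^{-1})-\tfrac{1}{2}a^{2}(x)\right)-\left(f(y)m(y^{-1})-\tfrac{1}{2}a^{2}(y)\right)-a(x)b(y)m(y^{-1})-a(y)b(x)m(x^{-1})$$ is bounded on $G\times G$; (10) $f(xy)=f(x)g(y)+g(x)f(y)+h(x)h(y)$ for all $x,y\in G$.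
   Context: $\mathcal{B}(G)$ denotes the linear space of all bounded complex-valued functions on $G$. A function $a:G\to\mathbb{C}$ is additive if $a(xy)=a(x)+a(y)$ for all $x,y\in G$. A function $m:G\to\mathbb{C}$ is multiplicative if $m(xy)=m(x)m(y)$ for all $x,y\in G$ (the zero function is allowed). Products and powers of functions are pointwise; in particular $a^{2}(x)=(a(x))^{2}$. *)

(* Defs.v *)
From HB Require Import structures.
From mathcomp Require Import all_boot all_order all_algebra.
From mathcomp Require Import all_classical all_reals all_analysis.
From mathcomp Require Import complex.

Set Implicit Arguments.
Unset Strict Implicit.
Unset Printing Implicit Defensive.

Import Order.TTheory GRing.Theory Num.Theory.
Import numFieldNormedType.Exports.

Local Open Scope ring_scope.
Local Open Scope complex_scope.

(* R[i]^o is R[i] seen as a normed module over itself. The domain is an arbitrary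
   type because boundedness is needed on G as well as on G * G. *)
Definition bounded_cfun (R : realType) (T : Type) (F : T -> R[i]) : Prop :=
  bounded_fun (F : T -> R[i]^o).

Section Functions.
Variables (R : realType) (G : groupType).

Definition additive_fun (a : G -> R[i]) : Prop :=
  {morph a : x y / (x * y)%g >-> x + y}.

(* The value at 1 is not prescribed, so the zero function is multiplicative. *)
Definition multiplicative_fun (m : G -> R[i]) : Prop :=
  {morph m : x y / (x * y)%g >-> x * y}.

(* mu is a left invariant mean on B(G) := bounded_cfun: a linear functional with
   mu 1 = 1 = ||mu||, invariant under left translations. The values of mu
   outside B(G) are irrelevant. *)
Record left_invariant_mean (mu : (G -> R[i]) -> R[i]) : Prop := {
  mean_linear : forall (c : R[i]) (F K : G -> R[i]),
    bounded_cfun F -> bounded_cfun K ->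
    mu (fun x => c * F x + K x) = c * mu F + mu K;
  mean_cst1 : mu (fun=> 1) = 1;
  mean_norm : forall (F : G -> R[i]) (r : R),
    (forall x, `|F x| <= r%:C) -> `|mu F| <= r%:C;
  mean_translate : forall (F : G -> R[i]) (y : G),
    bounded_cfun F -> mu (fun x => F (y * x)%g) = mu F
}.

End Functions.

(* Amenability of G as a discrete group. A group with a left invariant mean
   also has a two-sided invariant one, so choosing a side is harmless. *)
Definition amenable (R : realType) (G : groupType) : Prop :=
  exists mu : (G -> R[i]) -> R[i], left_invariant_mean mu.

(* Main.v *)
(* Everything is read modulo bounded functions. If the functions occurring in an
   addition formula f(xy) = sum_i phi_i(x) omega_i(y) + O(1) are linearly
   independent modulo bounded functions, comparing f((xy)z) with f(x(yz)) forces
   the error term to vanish; for f, g, h independent this is case (10). The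
   substitution h = k - beta f, which turns g into g + beta k - beta^2/2 f,
   preserves the form of the equation. If f is unbounded and h is dependent on f,
   it reduces to the stability of the sine equation, cases (3)-(5). If only g is
   dependent on f and h, it makes g = gamma f + b with b bounded. For gamma <> 0
   one completes the square and obtains an exact cosine equation, case (6). For
   gamma = 0 the function b is multiplicative and k is a cocycle twisted by b,
   either b times an additive function or a multiple of the difference of two
   multiplicative functions; what remains of f is then a derivation up to O(1),
   which is where amenability enters, and one gets (8) or (7). Case (9) is
   not needed in this direction. *)
Require Import Defs.
From HB Require Import structures.
From mathcomp Require Import all_boot all_order all_algebra.
From mathcomp Require Import all_classical all_reals all_analysis.
From mathcomp Require Import complex ring.

Set Implicit Arguments.
Unset Strict Implicit.
Unset Printing Implicit Defensive.

Import Order.TTheory GRing.Theory Num.Theory.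
Import numFieldNormedType.Exports.
Local Open Scope ring_scope.
Local Open Scope complex_scope.

(** * Algebra of bounded functions *)

Section Bounded.
Variable R : realType.

Lemma bounded_cfunP (T : Type) (F : T -> R[i]) :
  bounded_cfun F <-> exists M, forall x, `|F x| <= M.
Proof.
split=> [[M [_ FM]]|[M FM]].
  by exists (M + 1) => x; apply: FM => //; rewrite ltrDl.
exists `|M|; split=> [|N MN x _] /=; first exact: normr_real.
apply: le_trans (FM x) _.
by rewrite -(ger0_norm (le_trans (normr_ge0 _) (FM x))) ltW.
Qed.

Lemma bounded_cfun_ext (T : Type) (F K : T -> R[i]) :
  bounded_cfun F -> F =1 K -> bounded_cfun K.
Proof. by move=> bF /funext <-. Qed.

Lemma bounded_cfun_cst (T : Type) (c : R[i]) : bounded_cfun (fun _ : T => c).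
Proof. by apply/bounded_cfunP; exists `|c|. Qed.

Lemma bounded_cfunD (T : Type) (F K : T -> R[i]) :
  bounded_cfun F -> bounded_cfun K -> bounded_cfun (fun x => F x + K x).
Proof.
move=> /bounded_cfunP[M FM] /bounded_cfunP[N KN].
apply/bounded_cfunP; exists (M + N) => x.
exact: le_trans (ler_normD _ _) (lerD _ _).
Qed.

Lemma bounded_cfunN (T : Type) (F : T -> R[i]) :
  bounded_cfun F -> bounded_cfun (fun x => - F x).
Proof.
by move=> /bounded_cfunP[M FM]; apply/bounded_cfunP; exists M => x; rewrite normrN.
Qed.

Lemma bounded_cfunM (T : Type) (F K : T -> R[i]) :
  bounded_cfun F -> bounded_cfun K -> bounded_cfun (fun x => F x * K x).
Proof.
move=> /bounded_cfunP[M FM] /bounded_cfunP[N KN].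
by apply/bounded_cfunP; exists (M * N) => x; rewrite normrM ler_pM.
Qed.

Lemma bounded_cfun_comp (S T : Type) (k : S -> T) (F : T -> R[i]) :
  bounded_cfun F -> bounded_cfun (fun x => F (k x)).
Proof. by move=> /bounded_cfunP[M FM]; apply/bounded_cfunP; exists M. Qed.

Lemma bounded_cfun_sum (T : Type) (I : finType) (F : I -> T -> R[i]) :
  (forall i, bounded_cfun (F i)) -> bounded_cfun (fun x => \sum_i F i x).
Proof.
move=> bF; elim: (index_enum I) => [|i s IHs].
  by under eq_fun do rewrite big_nil; exact: bounded_cfun_cst.
by under eq_fun do rewrite big_cons; exact: bounded_cfunD.
Qed.

End Bounded.

Ltac bounded :=
  repeat match goal with
  | H : bounded_cfun ?F |- bounded_cfun ?F => exact: H
  | |- bounded_cfun (fun _ => ?c) => exact: bounded_cfun_cst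
  | H : bounded_cfun ?F |- bounded_cfun (fun x => ?F (@?k x)) =>
      exact: (bounded_cfun_comp k H)
  | |- bounded_cfun (fun x => @?F x + @?K x) => apply: bounded_cfunD
  | |- bounded_cfun (fun x => - @?F x) => apply: bounded_cfunN
  | |- bounded_cfun (fun x => @?F x * @?K x) => apply: bounded_cfunM
  end.

(** * Linear algebra: points dual to a free family *)

(** Points are added one at a time: while fewer than [n] are chosen, some nonzero combination of the
    [phi i] vanishes at all of them, and freeness gives a point where it does not. With [n] points
    the evaluation matrix is invertible, with inverse [D]. *)
Lemma dual_points (K : fieldType) (T : Type) n (phi : 'I_n -> T -> K) :
  (forall u : 'I_n -> K,
     (forall x, \sum_i u i * phi i x = 0) -> forall i, u i = 0) ->
  exists (p : 'I_n -> T) (D : 'M[K]_n),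
    forall k i, \sum_s D k s * phi i (p s) = (k == i)%:R.
Proof.
move=> phi_free.
have points k : (k <= n)%N ->
    exists p : 'I_k -> T, row_free (\matrix_(s, i) phi i (p s)).
  elim: k => [_|k IHk k_lt_n].
    have p0 : 'I_0 -> T by case.
    by exists p0; rewrite -row_leq_rank.
  have [p free_p] := IHk (ltnW k_lt_n).
  set A := \matrix_(s, i) _ in free_p.
  have /rowV0Pn : (cokermx A)^T != 0.
    rewrite -mxrank_eq0 mxrank_tr mxrank_coker (eqP free_p).
    by rewrite subn_eq0 -ltnNge.
  move=> [v /submxP[w vE] v_neq0].
  have Av0 : A *m v^T = 0 by rewrite vE trmx_mul trmxK mulmxA mulmx_coker mul0mx.
  have [x vx] : exists x, \sum_i v 0 i * phi i x != 0.
    apply: contrapT => /forallNP v0; case/eqP: v_neq0.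
    apply/rowP => i; rewrite mxE; apply: (phi_free (v 0)) => x.
    by apply: contrapT => /eqP; exact: v0.
  exists (fun s => if unlift ord0 s is Some t then p t else x).
  apply: inj_row_free => r rB0.
  have rE i : r 0 ord0 * phi i x + \sum_t r 0 (lift ord0 t) * A t i = 0.
    have /rowP/(_ i) := rB0; rewrite !mxE big_ord_recl mxE unlift_none => rBi.
    by rewrite -[RHS]rBi; congr (_ + _); apply: eq_bigr => t _; rewrite !mxE liftK.
  (* Pairing the relation [r] with [v] kills the old rows and leaves [r 0 ord0] times a value that
     is nonzero at the new point. *)
  have r0 : r 0 ord0 = 0.
    have : r 0 ord0 * (\sum_i v 0 i * phi i x) = 0.
      have : \sum_i v 0 i * (r 0 ord0 * phi i x
          + \sum_t r 0 (lift ord0 t) * A t i) = 0.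
        by apply: big1 => i _; rewrite rE mulr0.
      under eq_bigr do rewrite mulrDr.
      rewrite big_split /= [X in _ + X](_ : _ = 0) ?addr0.
        by move=> s0; rewrite -[RHS]s0 big_distrr /=; apply: eq_bigr => i _;
          rewrite mulrCA.
      under eq_bigr do rewrite big_distrr /=.
      rewrite exchange_big /= big1 // => t _.
      have /matrixP/(_ t 0) := Av0; rewrite !mxE => At0.
      transitivity (r 0 (lift ord0 t) * \sum_i A t i * v^T i 0).
        2: by rewrite At0 mulr0.
      rewrite big_distrr /=.
      by apply: eq_bigr => i _; rewrite !mxE mulrCA; congr (_ * _); exact: mulrC.
    by move/eqP; rewrite mulf_eq0 (negPf vx) orbF => /eqP.
  have rl : \row_t r 0 (lift ord0 t) = 0.
    apply: (row_free_inj free_p); rewrite mul0mx; apply/rowP => i.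
    rewrite !mxE -[RHS](rE i) r0 mul0r add0r.
    by apply: eq_bigr => t _; rewrite mxE.
  apply/rowP => s; rewrite !mxE; case: (unliftP ord0 s) => [t ->|-> //].
  by have /rowP/(_ t) := rl; rewrite !mxE.
have [p] := points n (leqnn n).
rewrite row_free_unit => p_unit.
exists p, (invmx (\matrix_(s, i) phi i (p s))) => k i.
have /matrixP/(_ k i) := mulVmx p_unit.
by rewrite !mxE => <-; apply: eq_bigr => s _; rewrite [in RHS]mxE.
Qed.

(** * Superstability of addition formulas *)

Section Superstability.
Variables (R : realType) (T : Type).

Definition free_mod_bounded n (phi : 'I_n -> T -> R[i]) :=
  forall u : 'I_n -> R[i],
    bounded_cfun (fun x => \sum_i u i * phi i x) -> forall i, u i = 0.

Lemma addition_superstable (op : T -> T -> T) (f : T -> R[i]) n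
    (c : 'I_n -> R[i]) (phi omega : 'I_n -> T -> R[i]) :
  associative op -> free_mod_bounded phi -> free_mod_bounded omega ->
  (forall x, f x = \sum_i c i * phi i x) ->
  bounded_cfun (fun p => f (op p.1 p.2) - \sum_i phi i p.1 * omega i p.2) ->
  forall x y, f (op x y) = \sum_i phi i x * omega i y.
Proof.
move=> opA phi_free omega_free fE.
pose psi p := f (op p.1 p.2) - \sum_i phi i p.1 * omega i p.2.
rewrite -/psi => psi_bd.
have psiE x y : f (op x y) = \sum_i phi i x * omega i y + psi (x, y).
  by rewrite /psi /= [RHS]addrC subrK.
have [p [D DE]] : exists (p : 'I_n -> T) (D : 'M[R[i]]_n),
    forall k i, \sum_s D k s * phi i (p s) = (k == i)%:R.
  apply: dual_points => u u0; apply: phi_free.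
  apply: (bounded_cfun_ext (@bounded_cfun_cst R T 0)) => x; by rewrite u0.
(* [y] is fixed from here on; [x] stays quantified because freeness of [phi] is applied to functions
   of [x]. *)
move=> x0 y; move: x0.
pose A k j := \sum_s D k s * phi j (op (p s) y).
have shift x z : \sum_i phi i x * omega i (op y z)
    = \sum_i phi i (op x y) * omega i z + (psi (op x y, z) - psi (x, op y z)).
  by apply: (addIr (psi (x, op y z))); rewrite -psiE opA psiE -addrA subrK.
(* Weighting [shift] at [x = p s] by [D k s] isolates [omega k]. *)
have omegaA k z : omega k (op y z) = \sum_j A k j * omega j z
    + \sum_s D k s * (psi (op (p s) y, z) - psi (p s, op y z)).
  transitivity (\sum_s D k s * \sum_i phi i (p s) * omega i (op y z)).
    transitivity (\sum_i (\sum_s D k s * phi i (p s)) * omega i (op y z)).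
      rewrite (bigD1 k) //= DE eqxx mul1r big1 ?addr0 // => i ik.
      by rewrite DE eq_sym (negPf ik) mul0r.
    under eq_bigr do rewrite big_distrl /=.
    rewrite exchange_big /=; apply: eq_bigr => s _.
    by rewrite big_distrr /=; apply: eq_bigr => i _; rewrite mulrA.
  under eq_bigr do rewrite shift mulrDr.
  rewrite big_split /=; congr (_ + _).
  under [RHS]eq_bigr do rewrite big_distrl /=.
  rewrite exchange_big /=; apply: eq_bigr => s _.
  by rewrite big_distrr /=; apply: eq_bigr => i _; rewrite mulrA.
(* The span of omega is stable under left translations modulo bounded
   functions, with matrix A; freeness then makes phi transform exactly by A. *)
have phiA x j : phi j (op x y) = \sum_i phi i x * A i j.
  apply/eqP; rewrite -subr_eq0; apply/eqP; move: j.
  apply: omega_free.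
  (* The values of [\sum_i phi i x * omega i (op y z)] given by [shift] and by [omegaA] are
     compared; only error terms remain. *)
  apply: (@bounded_cfun_ext _ _ (fun z => \sum_i phi i x *
     (\sum_s D i s * (psi (op (p s) y, z) - psi (p s, op y z)))
     - (psi (op x y, z) - psi (x, op y z)))).
    apply: bounded_cfunD; last by bounded.
    apply: bounded_cfun_sum => i; apply: bounded_cfunM; first by bounded.
    apply: bounded_cfun_sum => s; by bounded.
  move=> z; apply/eqP; rewrite subr_eq; apply/eqP.
  under [X in _ = X + _]eq_bigr do rewrite mulrBl.
  rewrite sumrB addrAC -shift; under [in RHS]eq_bigr do rewrite omegaA mulrDr.
  rewrite big_split /= addrAC.
  rewrite (_ : \sum_i phi i x * \sum_j A i j * omega j z
    = \sum_j (\sum_i phi i x * A i j) * omega j z) ?subrr ?add0r //.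
  under [RHS]eq_bigr do rewrite big_distrl /=.
  rewrite exchange_big /=; apply: eq_bigr => s _.
  by rewrite big_distrr /=; apply: eq_bigr => i _; rewrite mulrA.
(* Since [f] lies in the span of [phi], its translate by [y] has exact coefficients [C i]. Against
   [omega i y] they leave only [psi (x, y)], bounded in [x], so freeness of [phi] equates them. *)
pose C i := \sum_j c j * A i j.
have fC x : f (op x y) = \sum_i phi i x * C i.
  rewrite fE; under eq_bigr do rewrite phiA big_distrr /=.
  rewrite exchange_big /=; apply: eq_bigr => i _.
  by rewrite /C big_distrr /=; apply: eq_bigr => j _; rewrite mulrCA.
have C0 : forall i, C i - omega i y = 0.
  apply: phi_free; apply: (@bounded_cfun_ext _ _ (fun x => psi (x, y))).
    by bounded.
  move=> x; rewrite /psi /= fC -sumrB; apply: eq_bigr => i _.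
  by rewrite mulrBl ![_ * phi i x]mulrC.
move=> x; rewrite fC; apply: eq_bigr => i _.
by congr (_ * _); apply/eqP; rewrite -subr_eq0 C0.
Qed.

End Superstability.

(** * Linear independence modulo bounded functions *)

Section Free.
Variables (R : realType) (T : Type).
Implicit Types f g h : T -> R[i].

Lemma free_mod_bounded1 f :
  ~ bounded_cfun f -> free_mod_bounded (fun i : 'I_1 => nth (fun=> 0) [:: f] i).
Proof.
move=> f_unbd u bd i; rewrite ord1; apply: contrapT => /eqP u_neq0.
apply: f_unbd.
apply: (bounded_cfun_ext (bounded_cfunM (bounded_cfun_cst _ (u 0)^-1) bd)).
by move=> x; rewrite big_ord1 /= mulKf.
Qed.

Lemma free_mod_bounded2 f g :
  free_mod_bounded (fun i : 'I_2 => nth (fun=> 0) [:: f; g] i) <->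
  forall u v, bounded_cfun (fun x => u * f x + v * g x) -> u = 0 /\ v = 0.
Proof.
split=> [fg_free u v bd|fg_free u bd].
  have c0 := fg_free (fun i => nth 0 [:: u; v] i); split.
    apply: (c0 _ ord0); apply: (bounded_cfun_ext bd) => x.
    by rewrite !big_ord_recl big_ord0 /= addr0.
  apply: (c0 _ (lift ord0 ord0)); apply: (bounded_cfun_ext bd) => x.
  by rewrite !big_ord_recl big_ord0 /= addr0.
have [|u0 u1] := fg_free (u ord0) (u (lift ord0 ord0)).
  by apply: (bounded_cfun_ext bd) => x; rewrite !big_ord_recl big_ord0 /= addr0.
by move=> i; case: (unliftP ord0 i) => [j|] ->; rewrite ?(ord1 j).
Qed.

Lemma free_mod_bounded3 f g h :
  (forall u v w, bounded_cfun (fun x => u * f x + v * g x + w * h x) ->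
     [/\ u = 0, v = 0 & w = 0]) ->
  free_mod_bounded (fun i : 'I_3 => nth (fun=> 0) [:: f; g; h] i).
Proof.
move=> fgh_free u bd.
have [|u0 u1 u2] :=
  fgh_free (u ord0) (u (lift ord0 ord0)) (u (lift ord0 (lift ord0 ord0))).
  apply: (bounded_cfun_ext bd) => x.
  by rewrite !big_ord_recl big_ord0 /= addr0 addrA.
move=> i; case: (unliftP ord0 i) => [j|] -> //.
by case: (unliftP ord0 j) => [k|] -> //; rewrite (ord1 k).
Qed.

(** A nontrivial relation can be solved for [g], or, if its coefficient there is zero, for [f]. *)
Lemma free_mod_bounded2_span f g :
  ~ bounded_cfun f -> (forall c, ~ bounded_cfun (fun x => g x - c * f x)) ->
  forall u v, bounded_cfun (fun x => u * f x + v * g x) -> u = 0 /\ v = 0.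
Proof.
move=> f_unbd g_span u v bd.
have v0 : v = 0.
  apply: contrapT => /eqP v_neq0; apply: (g_span (- (u / v))).
  apply: (bounded_cfun_ext (bounded_cfunM (bounded_cfun_cst _ v^-1) bd)) => x.
  by field.
split=> //; apply: contrapT => /eqP u_neq0; apply: f_unbd.
apply: (bounded_cfun_ext (bounded_cfunM (bounded_cfun_cst _ u^-1) bd)) => x.
by rewrite v0; field.
Qed.

Lemma free_mod_bounded3_span f g h :
  (forall u v, bounded_cfun (fun x => u * f x + v * g x) -> u = 0 /\ v = 0) ->
  (forall c d, ~ bounded_cfun (fun x => h x - c * f x - d * g x)) ->
  forall u v w, bounded_cfun (fun x => u * f x + v * g x + w * h x) ->
  [/\ u = 0, v = 0 & w = 0].
Proof.
move=> fg_free h_span u v w bd.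
have w0 : w = 0.
  apply: contrapT => /eqP w_neq0; apply: (h_span (- (u / w)) (- (v / w))).
  apply: (bounded_cfun_ext (bounded_cfunM (bounded_cfun_cst _ w^-1) bd)) => x.
  by field.
have [|-> ->] := fg_free u v; last by split.
by apply: (bounded_cfun_ext bd) => x; rewrite w0 mul0r addr0.
Qed.

End Free.

(** * Exact exponential and trigonometric laws *)

Section TrigonometricSuperstability.
Variables (R : realType) (T : Type) (op : T -> T -> T).
Hypothesis opA : associative op.
Implicit Types f g h : T -> R[i].

Lemma exponential_superstable f :
  ~ bounded_cfun f -> bounded_cfun (fun p => f (op p.1 p.2) - f p.1 * f p.2) ->
  forall x y, f (op x y) = f x * f y.
Proof.
move=> /free_mod_bounded1 f_free bd x y.
rewrite (@addition_superstable _ _ _ _ _ (fun=> 1) _ _ opA f_free f_free).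
- by rewrite big_ord1.
- by move=> z; rewrite big_ord1 mul1r.
- by apply: (bounded_cfun_ext bd) => p; rewrite big_ord1.
Qed.

(** With the plus sign, left and right factors form the same family; a factor ['i] on [g] gives the
    usual cosine law. *)
Lemma cosine_superstable f g :
  (forall u v, bounded_cfun (fun x => u * f x + v * g x) -> u = 0 /\ v = 0) ->
  bounded_cfun (fun p => f (op p.1 p.2) - f p.1 * f p.2 - g p.1 * g p.2) ->
  forall x y, f (op x y) = f x * f y + g x * g y.
Proof.
move=> /free_mod_bounded2 fg_free bd x y.
(* Coordinates of [f] in the family: 1 on [f], and the default 0 of [nth] elsewhere. *)
rewrite (@addition_superstable _ _ _ _ _ (fun i => nth 0 [:: 1] i)
  _ _ opA fg_free fg_free).
- by rewrite !big_ord_recl big_ord0 /= addr0.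
- by move=> z; rewrite !big_ord_recl big_ord0 /=; ring.
- by apply: (bounded_cfun_ext bd) => p; rewrite !big_ord_recl big_ord0 /=; ring.
Qed.

(** The left factors are [f, g] and the right factors [g, f], so freeness is used in both orders. *)
Lemma sine_superstable f g :
  (forall u v, bounded_cfun (fun x => u * f x + v * g x) -> u = 0 /\ v = 0) ->
  bounded_cfun (fun p => f (op p.1 p.2) - f p.1 * g p.2 - g p.1 * f p.2) ->
  forall x y, f (op x y) = f x * g y + g x * f y.
Proof.
move=> fg_free bd x y.
have /free_mod_bounded2 gf_free : forall u v,
    bounded_cfun (fun x => u * g x + v * f x) -> u = 0 /\ v = 0.
  move=> u v bd'; apply/and_comm; apply: fg_free.
  by apply: (bounded_cfun_ext bd') => z; rewrite addrC.
move/free_mod_bounded2 in fg_free.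
rewrite (@addition_superstable _ _ _ _ _ (fun i => nth 0 [:: 1] i)
  _ _ opA fg_free gf_free).
- by rewrite !big_ord_recl big_ord0 /= addr0.
- by move=> z; rewrite !big_ord_recl big_ord0 /=; ring.
- by apply: (bounded_cfun_ext bd) => p; rewrite !big_ord_recl big_ord0 /=; ring.
Qed.

Lemma cosine_sine_superstable f g h :
  (forall u v w, bounded_cfun (fun x => u * f x + v * h x + w * g x) ->
     [/\ u = 0, v = 0 & w = 0]) ->
  bounded_cfun (fun p => f (op p.1 p.2) - f p.1 * g p.2 - g p.1 * f p.2
                         - h p.1 * h p.2) ->
  forall x y, f (op x y) = f x * g y + g x * f y + h x * h y.
Proof.
move=> fhg_free bd x y.
have /free_mod_bounded3 ghf_free : forall u v w,
    bounded_cfun (fun x => u * g x + v * h x + w * f x) ->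
    [/\ u = 0, v = 0 & w = 0].
  move=> u v w bd'; have [|-> -> ->] := fhg_free w v u; last by split.
  by apply: (bounded_cfun_ext bd') => z; ring.
move/free_mod_bounded3 in fhg_free.
rewrite (@addition_superstable _ _ _ _ _ (fun i => nth 0 [:: 1] i)
  _ _ opA fhg_free ghf_free).
- by rewrite !big_ord_recl big_ord0 /=; ring.
- by move=> z; rewrite !big_ord_recl big_ord0 /=; ring.
- by apply: (bounded_cfun_ext bd) => p; rewrite !big_ord_recl big_ord0 /=; ring.
Qed.

End TrigonometricSuperstability.

(** * The equation with a bounded coefficient [b] *)

(** Both expansions of [f] at a triple product are compared for fixed [x] and [y]. Terms where [z]
    enters only through [b] or an error are bounded in [z]; the others are displayed. *)
Lemma degenerate_associator (R : realType) (T : Type) (op : T -> T -> T)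
    (f b k : T -> R[i]) :
  associative op -> bounded_cfun b ->
  bounded_cfun (fun p => f (op p.1 p.2) - f p.1 * b p.2 - b p.1 * f p.2
                         - k p.1 * k p.2) ->
  forall x y, bounded_cfun (fun z => f z * (b (op x y) - b x * b y)
    + k z * (k (op x y) - b x * k y) - k x * k (op y z)).
Proof.
move=> opA b_bd.
pose psi p := f (op p.1 p.2) - f p.1 * b p.2 - b p.1 * f p.2 - k p.1 * k p.2.
rewrite -/psi => psi_bd x y.
have psiE u v : f (op u v) = f u * b v + b u * f v + k u * k v + psi (u, v).
  by rewrite /psi /=; ring.
apply: (@bounded_cfun_ext _ _ (fun z => f x * b (op y z)
  + b x * (f y * b z + psi (y, z)) + psi (x, op y z)
  - f (op x y) * b z - psi (op x y, z))); first by bounded.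
move=> z; have := psiE (op x y) z; rewrite -opA (psiE x (op y z)) (psiE y z).
by move/eqP; rewrite -subr_eq0 => /eqP E; rewrite -[LHS]subr0 -E; ring.
Qed.

(** Subtracting [k x / k x0] times the associator at [x0] eliminates [k (op y z)]. Freeness of [f]
    and [k] then makes both remaining coefficients vanish. *)
Lemma degenerate_cocycle (R : realType) (T : Type) (op : T -> T -> T)
    (f b k : T -> R[i]) :
  associative op ->
  (forall u v, bounded_cfun (fun x => u * f x + v * k x) -> u = 0 /\ v = 0) ->
  bounded_cfun b ->
  bounded_cfun (fun p => f (op p.1 p.2) - f p.1 * b p.2 - b p.1 * f p.2
                         - k p.1 * k p.2) ->
  (forall x y, b (op x y) = b x * b y) /\
  exists B, forall x y, k (op x y) = b x * k y + k x * B y.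
Proof.
move=> opA fk_free b_bd bd.
have assoc := degenerate_associator opA b_bd bd.
have [x0 kx0] : exists x, k x != 0.
  apply: contrapT => /forallNP k0; have [|_ /eqP] := fk_free 0 1.
    apply: (bounded_cfun_ext (@bounded_cfun_cst R T 0)) => x.
    by have /negP/negPn/eqP-> := k0 x; ring.
  by rewrite oner_eq0.
pose A y := (b (op x0 y) - b x0 * b y) / k x0.
pose B y := (k (op x0 y) - b x0 * k y) / k x0.
have coefs x y : b (op x y) - b x * b y - k x * A y = 0 /\
    k (op x y) - b x * k y - k x * B y = 0.
  apply: fk_free; apply: (bounded_cfun_ext (bounded_cfunD (assoc x y)
    (bounded_cfunM (bounded_cfun_cst _ (- k x / k x0)) (assoc x0 y)))) => z.
  by rewrite /A /B; field.
(* [k x * A y] is bounded in [x] because [b] is, while [k] is unbounded. *)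
have A0 y : A y = 0.
  have [|_ //] := fk_free 0 (A y).
  apply: (@bounded_cfun_ext _ _ (fun x => b (op x y) - b x * b y)).
    by bounded.
  by move=> x; have [/eqP] := coefs x y; rewrite subr_eq0 => /eqP-> _; ring.
split=> [x y|].
  by have [/eqP] := coefs x y; rewrite A0 mulr0 subr0 subr_eq0 => /eqP.
exists B => x y; have [_ /eqP] := coefs x y.
by rewrite -addrA -opprD subr_eq0 => /eqP.
Qed.

(** * Additive, derivation and sine stability on amenable groups *)

Section Amenable.
Variables (R : realType) (G : groupType).
Implicit Types (f g h k m a b : G -> R[i]).

Lemma multiplicative_neq0 m x :
  multiplicative_fun m -> (exists y, m y != 0) -> m x != 0.
Proof.
move=> mM [y]; apply: contra => /eqP mx0.
by rewrite -(mulVKg x y) mM mx0 mul0r.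
Qed.

Lemma multiplicative_inv m x :
  multiplicative_fun m -> (exists y, m y != 0) -> m (x^-1)%g = (m x)^-1.
Proof.
move=> mM m_neq0; have mx := multiplicative_neq0 x mM m_neq0.
have m1 : m 1%g = 1.
  apply: (mulfI (multiplicative_neq0 1%g mM m_neq0)).
  by rewrite -mM mulr1 mul1g.
by apply: (mulfI mx); rewrite -mM mulgV m1 mulfV.
Qed.

Hypothesis hG : amenable R G.

(* The additive function is the invariant mean of [x |-> k (y x) - k x]. *)
Lemma additive_stability k :
  bounded_cfun (fun p => k (p.1 * p.2)%g - k p.1 - k p.2) ->
  exists2 a, additive_fun a & bounded_cfun (fun x => k x - a x).
Proof.
pose psi p := k (p.1 * p.2)%g - k p.1 - k p.2.
rewrite -/psi => psi_bd; have [mu mean] := hG.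
pose D y x := k (y * x)%g - k x.
have DE y : D y = (fun x => k y * 1 + psi (y, x)).
  by apply/funext => x; rewrite /D /psi /=; ring.
have D_bd y : bounded_cfun (D y) by rewrite DE; bounded.
exists (fun y => mu (D y)) => [y z|].
  (* [D (y * z) x = D y (z * x) + D z x], and left invariance discards the shift by [z]. *)
  rewrite -(mean_translate mean z (D_bd y)) -[X in X + _]mul1r.
  have Dz_bd : bounded_cfun (fun x => D y (z * x)%g).
    exact: bounded_cfun_comp (D_bd y).
  rewrite -(mean_linear mean 1 Dz_bd (D_bd z)); congr mu.
  by apply/funext => x; rewrite /D mulgA; ring.
have /bounded_cfunP[M psiM] := psi_bd.
(* [mean_norm] takes a real bound; [M] is real because it dominates a norm. *)
have M_real : (complex.Re M)%:C = M.
  by apply: RRe_real; apply: ger0_real; apply: le_trans (psiM (1, 1)%g).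
apply/bounded_cfunP; exists M => y.
have psiy_bd : bounded_cfun (fun x => psi (y, x)) by bounded.
rewrite DE (mean_linear mean _ (bounded_cfun_cst _ _) psiy_bd).
rewrite (mean_cst1 mean) mulr1 opprD addNKr normrN -M_real.
by apply: (mean_norm mean) => x; rewrite M_real.
Qed.

(** Dividing by [m] reduces this to additive stability: the defect is multiplied by
    [m ((x * y)^-1)], which is bounded. *)
Lemma derivation_stability k m :
  multiplicative_fun m -> bounded_cfun m -> (exists x, m x != 0) ->
  bounded_cfun (fun p => k (p.1 * p.2)%g - k p.1 * m p.2 - m p.1 * k p.2) ->
  exists a phi, [/\ additive_fun a, bounded_cfun phi &
                    forall x, k x = a x * m x + phi x].
Proof.
move=> mM m_bd m_ex bd.
have m_neq0 x := multiplicative_neq0 x mM m_ex.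
have mV x := multiplicative_inv x mM m_ex.
have [|a a_add phi_bd] := @additive_stability (fun x => k x / m x).
  apply: (bounded_cfun_ext (bounded_cfunM bd
    (bounded_cfun_comp (fun p : G * G => (p.1 * p.2)^-1)%g m_bd))) => -[x y] /=.
  have := m_neq0 x; have := m_neq0 y; rewrite mV mM => my mx; by field; apply/andP.
exists a, (fun x => (k x / m x - a x) * m x); split=> //; first by bounded.
by move=> x; field.
Qed.

(** Either [g] is independent of [f] and the law is exact, or [g = c * f + b]: for [c = 0], [f] is a
    derivation over [b] up to a bounded error; for [c != 0] a square is completed. *)
Lemma sine_stability f g :
  ~ bounded_cfun f ->
  bounded_cfun (fun p => f (p.1 * p.2)%g - f p.1 * g p.2 - g p.1 * f p.2) ->
  [\/ exists a m phi,
        [/\ additive_fun a, multiplicative_fun m, bounded_cfun m,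
            bounded_cfun phi &
            forall x, f x = a x * m x + phi x /\ g x = m x],
      exists c m b,
        [/\ multiplicative_fun m, bounded_cfun b &
            forall x, f x = c * m x - c * b x /\ g x = (m x + b x) / 2]
    | forall x y, f (x * y)%g = f x * g y + g x * f y].
Proof.
move=> f_unbd bd.
have [[c b_bd]|g_span] := pselect (exists c, bounded_cfun (fun x => g x - c * f x));
  last first.
  apply: Or33; apply: (sine_superstable (@mulgA G)) bd.
  by apply: (free_mod_bounded2_span f_unbd) => c c_bd; apply: g_span; exists c.
pose b x := g x - c * f x; rewrite -/b in b_bd.
have gE x : g x = c * f x + b x by rewrite /b addrC subrK.
have [c0|c_neq0] := eqVneq c 0.
  have {}gE x : g x = b x by rewrite gE c0 mul0r add0r.
  have {}bd : bounded_cfun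
      (fun p => f (p.1 * p.2)%g - f p.1 * b p.2 - b p.1 * f p.2).
    by apply: (bounded_cfun_ext bd) => p; rewrite !gE.
  (* With [k = 0] the associator is [f] times the multiplicativity defect of [b], and [f] is
     unbounded. *)
  have bM : multiplicative_fun b.
    move=> x y; apply/eqP; rewrite -subr_eq0; apply/eqP.
    apply: contrapT => /eqP d_neq0; apply: f_unbd.
    have bd0 : bounded_cfun (fun p => f (p.1 * p.2)%g - f p.1 * b p.2
        - b p.1 * f p.2 - 0 * 0).
      by apply: (bounded_cfun_ext bd) => p; ring.
    have := degenerate_associator (k := fun=> 0) (@mulgA G) b_bd bd0 x y.
    rewrite /=; set d := b (x * y)%g - b x * b y in d_neq0 *.
    move=> /(bounded_cfunM (bounded_cfun_cst _ d^-1)) /bounded_cfun_ext; apply.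
    by move=> z; field.
  have b_ex : exists x, b x != 0.
    apply: contrapT => /forallNP b0; apply: f_unbd.
    apply: (bounded_cfun_ext (bounded_cfun_comp (fun x : G => (x, 1%g)) bd)) => x /=.
    have {}b0 y : b y = 0 by have /negP/negPn/eqP := b0 y.
    by rewrite !b0 mulg1; ring.
  have [a [phi [a_add phi_bd fE]]] := derivation_stability bM b_bd b_ex bd.
  by apply: Or31; exists a, b, phi; split.
have c2 : 2 * c != 0 by rewrite mulf_neq0 ?pnatr_eq0.
(* Completing the square: [F x * F y] is [2 * c] times the right side of the sine law plus
   [b x * b y]. *)
pose F x := 2 * c * f x + b x.
have FM : multiplicative_fun F.
  apply: (exponential_superstable (@mulgA G)).
    move=> F_bd; apply: f_unbd; apply: (@bounded_cfun_ext _ _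
      (fun x => (2 * c)^-1 * (F x - b x))); first by bounded.
    by move=> x; rewrite /F; field.
  apply: (@bounded_cfun_ext _ _ (fun p => 2 * c *
    (f (p.1 * p.2)%g - f p.1 * g p.2 - g p.1 * f p.2) + b (p.1 * p.2)%g
    - b p.1 * b p.2)); first by bounded.
  by move=> p; rewrite /F !gE; ring.
apply: Or32; exists (2 * c)^-1, F, b; split=> // x.
by rewrite gE /F; split; field.
Qed.

End Amenable.

(** * Solving the degenerate equation on an amenable group *)

Lemma degenerate_stability (R : realType) (G : groupType) (hG : amenable R G)
    (f m k : G -> R[i]) :
  (forall u v, bounded_cfun (fun x => u * f x + v * k x) -> u = 0 /\ v = 0) ->
  bounded_cfun m ->
  bounded_cfun (fun p => f (p.1 * p.2)%g - f p.1 * m p.2 - m p.1 * f p.2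
                         - k p.1 * k p.2) ->
  [/\ multiplicative_fun m, exists x, m x != 0 &
   (exists c M a phi,
      [/\ c != 0, multiplicative_fun M, additive_fun a, bounded_cfun phi &
       forall x, k x = c * (M x - m x) /\ f x = c ^+ 2 * M x + a x * m x + phi x])
   \/
   (exists a a1 phi,
      [/\ additive_fun a, additive_fun a1, bounded_cfun phi,
       exists x, a x != 0 &
       forall x, k x = a x * m x /\
         f x = a x ^+ 2 / 2 * m x + a1 x / 2 * m x + phi x])].
Proof.
move=> fk_free m_bd bd.
have [mM [B kB]] := degenerate_cocycle (@mulgA G) fk_free m_bd bd.
(* The equation is symmetric in its variables, so it also holds for the
   opposite group. *)
have [_ [M kM]] : (forall x y, m (y * x)%g = m x * m y) /\
    exists M, forall x y, k (y * x)%g = m x * k y + k x * M y.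
  apply: (degenerate_cocycle (op := fun x y => (y * x)%g) _ fk_free m_bd).
    by move=> x y z; rewrite mulgA.
  apply: (bounded_cfun_ext
    (bounded_cfun_comp (fun p : G * G => (p.2, p.1)) bd)) => p /=; ring.
have [x0 kx0] : exists x, k x != 0.
  apply: contrapT => /forallNP k0; have [|_ /eqP] := fk_free 0 1.
    apply: (bounded_cfun_ext (bounded_cfun_cst G (0 : R[i]))) => x.
    by have /negP/negPn/eqP-> := k0 x; ring.
  by rewrite oner_eq0.
have m_ex : exists x, m x != 0.
  apply: contrapT => /forallNP m0.
  have {}m0 x : m x = 0 by have /negP/negPn/eqP := m0 x.
  (* If [m] were zero, setting the second variable to 1 would make [f - k 1 * k] bounded. *)
  have [|/eqP] := fk_free 1 (- k 1%g); last by rewrite oner_eq0.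
  apply: (bounded_cfun_ext
    (bounded_cfun_comp (fun x : G => (x, 1%g)) bd)) => x /=.
  by rewrite !m0 mulg1; ring.
have m_neq0 x := multiplicative_neq0 x mM m_ex.
split=> //.
have [BE|/existsNP[y0 By0]] := pselect (forall y, B y = m y).
  right; pose a x := k x / m x.
  have kE x : k x = a x * m x by rewrite /a divfK.
  have a_add : additive_fun a.
    move=> x y; rewrite /a mM kB BE; have := m_neq0 x; have := m_neq0 y.
    by move=> my mx; field; apply/andP.
  (* Half the square of an additive function has cross term [a x * a y], which accounts for
     [k x * k y]. *)
  have [|a1 [phi [a1_add phi_bd fE]]] :=
      @derivation_stability _ _ hG (fun x => f x - a x ^+ 2 / 2 * m x) _ mM m_bd m_ex.
    apply: (bounded_cfun_ext bd) => p.
    by rewrite !kE mM a_add; field.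
  exists a, (fun x => 2 * a1 x), phi; split=> //.
  - by move=> x y; rewrite a1_add mulrDr.
  - by exists x0; apply: contra kx0 => /eqP a0; rewrite kE a0 mul0r.
  - move=> x; split=> //; move: (fE x) => /eqP; rewrite subr_eq => /eqP ->.
    by field.
(* The left and right cocycle formulas for [k (x * y0)] are equated; their difference expresses [k]
   through [M - m]. *)
left; pose c := k y0 / (B y0 - m y0).
have d_neq0 : B y0 - m y0 != 0 by rewrite subr_eq0; apply/eqP.
have kE x : k x = c * (M x - m x).
  have : k x * (B y0 - m y0) = k y0 * (M x - m x).
    apply: (addrI (m x * k y0 + k x * m y0)).
    transitivity (k (x * y0)%g); first by rewrite kB; ring.
    by rewrite kM; ring.
  move=> E; rewrite /c mulrAC -E; exact/esym/mulfK.
have c_neq0 : c != 0.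
  by apply: contra kx0 => /eqP c0; rewrite kE c0 mul0r.
have MM : multiplicative_fun M.
  move=> x y; apply: (mulfI c_neq0); apply: (addIr (- c * (m x * m y))).
  transitivity (k (x * y)%g); first by rewrite kE mM; ring.
  by rewrite kM !kE; ring.
(* Subtracting [c ^+ 2 * M] absorbs [k x * k y] up to a multiple of the bounded product
   [m x * m y]. *)
have [|a [phi [a_add phi_bd fE]]] :=
    @derivation_stability _ _ hG (fun x => f x - c ^+ 2 * M x) _ mM m_bd m_ex.
  apply: (@bounded_cfun_ext _ _ (fun p => f (p.1 * p.2)%g - f p.1 * m p.2
    - m p.1 * f p.2 - k p.1 * k p.2 + c ^+ 2 * m p.1 * m p.2)).
    by apply: bounded_cfunD => //; bounded.
  by move=> p; rewrite !kE MM; ring.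
exists c, M, a, phi; split=> // x; split=> //.
by move: (fE x) => /eqP; rewrite subr_eq => /eqP ->; ring.
Qed.

(** * The classification *)

Theorem theorem4p1 (R : realType) (G : groupType) (hG : amenable R G)
    (f g h : G -> R[i]) :
  bounded_cfun (fun p : G * G =>
    f (p.1 * p.2)%g - f p.1 * g p.2 - g p.1 * f p.2 - h p.1 * h p.2)
  <->
  ((* (1) *)
   ((forall x, f x = 0) /\ bounded_cfun h)
   \/ (* (2) *)
   [/\ bounded_cfun f, bounded_cfun g & bounded_cfun h]
   \/ (* (3) *)
   (exists (lam : R[i]) (a m b phi : G -> R[i]),
     [/\ additive_fun a, multiplicative_fun m /\ bounded_cfun m,
         bounded_cfun b /\ bounded_cfun phi &
      [/\ forall x, f x = a x * m x + phi x,
          forall x, g x = (1 - lam ^+ 2 / 2 * a x) * m x - lam * b x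
                          - lam ^+ 2 / 2 * phi x &
          forall x, h x = lam * a x * m x + b x + lam * phi x]])
   \/ (* (4) *)
   (exists (alpha lam : R[i]) (m b phi : G -> R[i]),
     [/\ multiplicative_fun m, bounded_cfun b, bounded_cfun phi &
      [/\ forall x, f x = alpha * m x - alpha * b x,
          forall x, g x = (1 - alpha * lam ^+ 2) / 2 * m x
                          + (1 + alpha * lam ^+ 2) / 2 * b x - lam * phi x &
          forall x, h x = alpha * lam * m x - alpha * lam * b x + phi x]])
   \/ (* (5) *)
   (exists (lam : R[i]) (b f0 g0 : G -> R[i]),
     [/\ bounded_cfun b,
         forall x y, f0 (x * y)%g = f0 x * g0 y + g0 x * f0 y &
      [/\ forall x, f x = f0 x,
          forall x, g x = g0 x - lam ^+ 2 / 2 * f0 x - lam * b x &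
          forall x, h x = lam * f0 x + b x]])
   \/ (* (6) *)
   (exists (rho lam : R[i]) (b f0 g0 : G -> R[i]),
     [/\ lam != 0, bounded_cfun b,
         forall x y, f0 (x * y)%g = f0 x * f0 y - g0 x * g0 y &
      [/\ forall x, f x = - lam ^+ 2 * f0 x + lam ^+ 2 * b x,
          forall x, g x = (1 + rho ^+ 2) / 2 * f0 x + rho * g0 x
                          + (1 - rho ^+ 2) / 2 * b x &
          forall x, h x = lam * rho * f0 x + lam * g0 x - lam * rho * b x]])
   \/ (* (7) *)
   (exists (beta lam : R[i]) (m M a b : G -> R[i]),
     [/\ lam != 0, multiplicative_fun m /\ multiplicative_fun M,
         bounded_cfun m, additive_fun a /\ bounded_cfun b &
      [/\ forall x, f x = lam ^+ 2 * M x + a x * m x + b x,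
          forall x, g x = beta * lam * (1 - 1 / 2 * beta * lam) * M x
                          + (1 - beta * lam) * m x
                          - 1 / 2 * beta ^+ 2 * a x * m x
                          - 1 / 2 * beta ^+ 2 * b x &
          forall x, h x = lam * (1 - beta * lam) * M x - lam * m x
                          - beta * a x * m x - beta * b x]])
   \/ (* (8) *)
   (exists (beta : R[i]) (m a a1 b : G -> R[i]),
     [/\ (exists x, m x != 0), bounded_cfun m /\ multiplicative_fun m,
         [/\ additive_fun a, additive_fun a1 & exists x, a x != 0],
         bounded_cfun b &
      [/\ forall x, f x = 1 / 2 * a x ^+ 2 * m x + 1 / 2 * a1 x * m x + b x,
          forall x, g x = - (1 / 4) * beta ^+ 2 * a x ^+ 2 * m x
                          + beta * a x * m x
                          - 1 / 4 * beta ^+ 2 * a1 x * m x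
                          + m x - 1 / 2 * beta ^+ 2 * b x &
          forall x, h x = - (1 / 2) * beta * a x ^+ 2 * m x + a x * m x
                          - 1 / 2 * beta * a1 x * m x - beta * b x]])
   \/ (* (9) *)
   (exists (beta : R[i]) (a m b : G -> R[i]),
     [/\ additive_fun a,
         [/\ exists x, m x != 0, bounded_cfun m & multiplicative_fun m],
         bounded_cfun b,
         (forall x, g x = - (1 / 2) * beta ^+ 2 * f x + (1 + beta * a x) * m x
                          + beta * b x) /\
         (forall x, h x = - beta * f x + a x * m x + b x) &
         bounded_cfun (fun p : G * G => let: (x, y) := p in
           f (x * y)%g * m ((x * y)^-1)%g - 1 / 2 * a (x * y)%g ^+ 2
           - (f x * m (x^-1)%g - 1 / 2 * a x ^+ 2)
           - (f y * m (y^-1)%g - 1 / 2 * a y ^+ 2)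
           - a x * b y * m (y^-1)%g - a y * b x * m (x^-1)%g)])
   \/ (* (10) *)
   (forall x y, f (x * y)%g = f x * g y + g x * f y + h x * h y)).
Proof.
(* Sufficiency: in most cases substitution reduces the defect to an explicit function built from
   bounded ones. *)
split=> [bd|]; last first.
  case=> [[f0 h_bd]|].
    apply: (@bounded_cfun_ext _ _ (fun p => - (h p.1 * h p.2))); first by bounded.
    by move=> p; rewrite !f0; ring.
  case=> [[f_bd g_bd h_bd]|].
    have f_bd' : bounded_cfun (fun p : G * G => f (p.1 * p.2)%g).
      exact: bounded_cfun_comp f_bd.
    by bounded.
  case=> [[lam [a [m [b [phi [aD [mM m_bd] [b_bd phi_bd] [fE gE hE]]]]]]]|].
    apply: (@bounded_cfun_ext _ _ (fun p => phi (p.1 * p.2)%g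
      - phi p.1 * m p.2 - m p.1 * phi p.2 - b p.1 * b p.2)); first by bounded.
    by move=> p; rewrite !fE !gE !hE mM aD; field.
  case=> [[al [lam [m [b [phi [mM b_bd phi_bd [fE gE hE]]]]]]]|].
    apply: (@bounded_cfun_ext _ _ (fun p => - al * b (p.1 * p.2)%g
      + al * b p.1 * b p.2 - phi p.1 * phi p.2)); first by bounded.
    by move=> p; rewrite !fE !gE !hE mM; field.
  case=> [[lam [b [f0 [g0 [b_bd f0E [fE gE hE]]]]]]|].
    apply: (@bounded_cfun_ext _ _ (fun p => - (b p.1 * b p.2))); first by bounded.
    by move=> p; rewrite !fE !gE !hE f0E; field.
  case=> [[rho [lam [b [f0 [g0 [_ b_bd f0E [fE gE hE]]]]]]]|].
    apply: (@bounded_cfun_ext _ _ (fun p => lam ^+ 2 * b (p.1 * p.2)%g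
      - lam ^+ 2 * b p.1 * b p.2)); first by bounded.
    by move=> p; rewrite !fE !gE !hE f0E; field.
  case=> [[be [lam [m [M [a [b [_ [mM MM] m_bd [aD b_bd] [fE gE hE]]]]]]]]|].
    apply: (@bounded_cfun_ext _ _ (fun p => b (p.1 * p.2)%g
      - b p.1 * m p.2 - m p.1 * b p.2 - lam ^+ 2 * m p.1 * m p.2)); first by bounded.
    by move=> p; rewrite !fE !gE !hE mM MM aD; field.
  case=> [[be [m [a [a1 [b [_ [m_bd mM] [aD a1D _] b_bd [fE gE hE]]]]]]]|].
    apply: (@bounded_cfun_ext _ _ (fun p => b (p.1 * p.2)%g
      - b p.1 * m p.2 - m p.1 * b p.2)); first by bounded.
    by move=> p; rewrite !fE !gE !hE mM aD a1D; field.
  case=> [[be [a [m [b [aD [m_ex m_bd mM] b_bd [gE hE] bd]]]]]|].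
    set E := (fun p => _) in bd.
    (* Multiplying by [m (x * y)] undoes the normalisation by inverses in [E]. *)
    apply: (@bounded_cfun_ext _ _ (fun p => m (p.1 * p.2)%g * E p
      - b p.1 * b p.2)); first by bounded.
    move=> [x y] /=; rewrite /E !gE !hE !(multiplicative_inv _ mM m_ex) mM aD.
    have mx := multiplicative_neq0 x mM m_ex.
    have my := multiplicative_neq0 y mM m_ex.
    by field; apply/andP.
  move=> fE; apply: (bounded_cfun_ext (@bounded_cfun_cst R (G * G)%type 0)) => p.
  by rewrite fE; ring.
have [f_bd|f_unbd] := pselect (bounded_cfun f).
  have slice y : bounded_cfun (fun x => g x * f y + h x * h y).
    apply: (@bounded_cfun_ext _ _ (fun x => f (x * y)%g - f x * g y
      - (f (x * y)%g - f x * g y - g x * f y - h x * h y))).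
      apply: bounded_cfunD; first by bounded.
      exact: bounded_cfunN (bounded_cfun_comp (fun x : G => (x, y)) bd).
    by move=> x; ring.
  have [f0|/existsNP[x0 /eqP fx0]] := pselect (forall x, f x = 0).
    left; split=> //; apply: contrapT => h_unbd; apply: h_unbd.
    have [h0|/existsNP[y0 /eqP hy0]] := pselect (forall x, h x = 0).
      by apply: (bounded_cfun_ext (bounded_cfun_cst G (0 : R[i]))) => x; rewrite h0.
    apply: (bounded_cfun_ext
      (bounded_cfunM (slice y0) (bounded_cfun_cst _ (h y0)^-1))) => x.
    by rewrite f0; field.
  have [h_bd|h_unbd] := pselect (bounded_cfun h).
    right; left; split=> //; apply: (bounded_cfun_ext (bounded_cfunM
      (bounded_cfunD (slice x0) (bounded_cfunM h_bd (bounded_cfun_cst _ (- h x0))))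
      (bounded_cfun_cst _ (f x0)^-1))) => x.
    by field.
  (* Eliminating [g] between the slices at [y] and [x0] leaves a multiple of the unbounded [h], so
     its coefficient is zero. *)
  have hE y : h y = h x0 / f x0 * f y.
    apply/eqP; rewrite -subr_eq0; set d := _ - _.
    apply: contrapT => /negP d_neq0; apply: h_unbd.
    apply: (bounded_cfun_ext (bounded_cfunM (bounded_cfunD (slice y)
      (bounded_cfunM (bounded_cfun_cst _ (- (f y / f x0))) (slice x0)))
      (bounded_cfun_cst _ d^-1))) => x.
    by apply: (canLR (mulfK d_neq0)); rewrite /d; field.
  case: h_unbd; apply: (bounded_cfun_ext
    (bounded_cfunM (bounded_cfun_cst _ (h x0 / f x0)) f_bd)) => y.
  exact/esym/hE.
have [[lam b_bd]|h_span] := pselect (exists c, bounded_cfun (fun x => h x - c * f x)).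
  pose b x := h x - lam * f x; rewrite -/b in b_bd.
  have hE x : h x = lam * f x + b x by rewrite /b addrC subrK.
  (* [g'] absorbs the terms of [h x * h y] containing [f]; only [b x * b y] is left. *)
  pose g' x := g x + lam ^+ 2 / 2 * f x + lam * b x.
  have gE x : g x = g' x - lam ^+ 2 / 2 * f x - lam * b x by rewrite /g'; ring.
  have [|a_case|m_case|f0_case] := @sine_stability _ _ hG f g' f_unbd.
  - apply: (@bounded_cfun_ext _ _ (fun p => f (p.1 * p.2)%g - f p.1 * g p.2
      - g p.1 * f p.2 - h p.1 * h p.2 + b p.1 * b p.2)).
      by apply: bounded_cfunD => //; bounded.
    by move=> p; rewrite !hE !gE; field.
  - have [a [m [phi [aD mM m_bd phi_bd E]]]] := a_case.
    do 2!right; left; exists lam, a, m, b, phi; split=> //.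
    by split=> x; have [fE g'E] := E x; rewrite ?gE ?hE ?g'E ?fE; field.
  - have [c [m [phi [mM phi_bd E]]]] := m_case.
    do 3!right; left; exists c, lam, m, phi, b; split=> //.
    by split=> x; have [fE g'E] := E x; rewrite ?gE ?hE ?g'E ?fE; field.
  - by do 4!right; left; exists lam, b, f, g'.
have fh_free := free_mod_bounded2_span f_unbd
  (fun c c_bd => h_span (ex_intro _ c c_bd)).
have [[al [be b_bd]]|g_span] := pselect
    (exists c d, bounded_cfun (fun x => g x - c * f x - d * h x)); last first.
  do 9!right; apply: (cosine_sine_superstable (@mulgA G) _ bd).
  apply: (free_mod_bounded3_span fh_free) => c d cd_bd.
  by apply: g_span; exists c, d.
pose b x := g x - al * f x - be * h x; rewrite -/b in b_bd.
pose k x := h x + be * f x.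
have hE x : h x = k x - be * f x by rewrite /k addrK.
(* Writing [h = k - be * f] cancels the cross terms in [f] and [k]; [ga] is the remaining multiple
   of [f] in [g]. *)
pose ga := al - be ^+ 2 / 2.
have gE x : g x = ga * f x + b x + be * k x - be ^+ 2 / 2 * f x.
  by rewrite /ga /b /k; field.
have fk_free u v : bounded_cfun (fun x => u * f x + v * k x) -> u = 0 /\ v = 0.
  move=> uv_bd; have [|u0 v0] := fh_free (u + v * be) v.
    by apply: (bounded_cfun_ext uv_bd) => x; rewrite /k; ring.
  by move: u0; rewrite v0 mul0r addr0.
have fk_bd : bounded_cfun (fun p => f (p.1 * p.2)%g
    - f p.1 * (ga * f p.2 + b p.2) - (ga * f p.1 + b p.1) * f p.2 - k p.1 * k p.2).
  by apply: (bounded_cfun_ext bd) => p; rewrite !gE !hE; field.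
have [ga0|ga_neq0] := eqVneq ga 0.
  have [|mM m_ex [[c [M [a [phi [c_neq0 MM aD phi_bd E]]]]]|
                  [a [a1 [phi [aD a1D phi_bd a_ex E]]]]]] :=
      degenerate_stability hG fk_free b_bd.
  - by apply: (bounded_cfun_ext fk_bd) => p; rewrite ga0; ring.
  - do 6!right; left; exists be, c, b, M, a, phi; split=> //.
    by split=> x; have [kE fE] := E x; rewrite ?gE ?hE ?kE ?fE ?ga0; field.
  - do 7!right; left; exists be, b, a, a1, phi; split=> //.
    by split=> x; have [kE fE] := E x; rewrite ?gE ?hE ?kE ?fE ?ga0; field.
(* Multiplying the equation by [2 * ga] completes the square in [F], and [s] makes the last term
   [K x * K y]. *)
pose s := sqrtC (2 * ga).
have s2 : s ^+ 2 = 2 * ga by rewrite sqrtCK.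
have s_neq0 : s != 0 by rewrite sqrtC_eq0 mulf_neq0 ?pnatr_eq0.
have gaE : ga = s ^+ 2 / 2 by rewrite s2; field.
pose F x := 2 * ga * f x + b x.
pose K x := s * k x.
have FK : forall x y, F (x * y)%g = F x * F y + K x * K y.
  apply: (cosine_superstable (@mulgA G)).
    move=> u v uv_bd; have [|u0 v0] := fk_free (2 * ga * u) (s * v).
      apply: (@bounded_cfun_ext _ _ (fun x => u * F x + v * K x - u * b x)).
        by apply: bounded_cfunD => //; bounded.
      by move=> x; rewrite /F /K; ring.
    split; apply/eqP; [move/eqP: u0|move/eqP: v0].
      by rewrite !mulf_eq0 pnatr_eq0 (negPf ga_neq0).
    by rewrite mulf_eq0 (negPf s_neq0).
  apply: (@bounded_cfun_ext _ _ (fun p => 2 * ga * (f (p.1 * p.2)%g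
    - f p.1 * (ga * f p.2 + b p.2) - (ga * f p.1 + b p.1) * f p.2 - k p.1 * k p.2)
    + b (p.1 * p.2)%g - b p.1 * b p.2)).
    do 2!(apply: bounded_cfunD; last by bounded).
    exact: bounded_cfunM (bounded_cfun_cst _ _) fk_bd.
  by move=> p; rewrite /F /K gaE; field.
(* The factor [j] turns [+ K x * K y] into the minus sign of the cosine law. The witnesses come from
   [f = (F - b) / s ^+ 2] and [h = K / s - be * f]. *)
pose j : R[i] := 'i.
have j2 : j ^+ 2 = - 1 by rewrite /j sqrCi.
do 5!right; left.
exists (- be * j / s), (- j / s), b, F, (fun x => j * K x).
have j_neq0 : j != 0 by rewrite /j neq0Ci.
split=> //.
- by rewrite mulf_neq0 ?oppr_eq0 ?invr_eq0.
- by move=> x y; rewrite FK; ring: j2.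
- by split=> x; rewrite ?gE ?hE /F /K gaE; field: j2.
Qed.
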